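(* Let $G$ be a fixed edge-ordered graph with labeling $l$, minimal edge $e_0$ and maximal edge $e_{\max}$. If $ab\in\{e_0,e_{\max}\}$ and there exist two vertices $v,w\in N_G(a)\cap N_G(b)$ such that $l(av)<l(aw)$ and $l(bv)>l(bw)$, then \[sat_e(n,G)\ \ge\ ssat_e(n,G)=\Omega(n\sqrt{\log n}).\]
   Context: An edge-ordered graph is a finite simple graph together with a linear order on its edge set given by an injective labeling $l:E\to\mathbb{N}$ (or $l:E\to\mathbb{R}$). An edge-ordered graph $H$ contains $G$ (has a copy of $G$) if $G$ is isomorphic, by an isomorphism respecting the edge-order, to a subgraph of $H$ with the induced order; otherwise $H$ is $G$-free. The minimal (maximal) edge is the edge with the smallest (largest) label. $N_G(a)$ denotes the open neighborhood of $a$ in $G$. $ssat_e(n,G)$ is the minimum number of edges in an edge-ordered graph $H$ on $n$ vertices such that adding to $H$ any missing edge, inserted at an arbitrary position of the linear order of the edges, creates a new copy of $G$ (one using the added edge); that is, for every missing edge and every position a new copy is created. $sat_e(n,G)$ is defined in the same way with the additional requirement that $H$ is $G$-free. Asymptotic notation is for $n\to\infty$ with $G$ fixed. *)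

(* Defs.v *)
From mathcomp Require Import all_boot all_order all_algebra.
From mathcomp Require Import all_classical all_reals all_analysis.

Set Implicit Arguments.
Unset Strict Implicit.
Unset Printing Implicit Defensive.

Import Order.TTheory GRing.Theory Num.Theory.
Import numFieldNormedType.Exports.

Local Open Scope ring_scope.

(* Simple graphs: an edge is a two-element set of vertices.  The values of
   [label] outside [edges] carry no meaning. *)
Record eograph (R : realType) (V : finType) := EOGraph {
  edges : {set {set V}};
  label : {set V} -> R;
  card_edge : forall e, e \in edges -> #|e| = 2%N;
  label_inj : {in edges &, injective label}
}.

Section EdgeOrdered.
Variable R : realType.

Definition nbr (V : finType) (G : eograph R V) (a : V) : {set V} :=
  [set u | [set a; u] \in edges G].

Definition minimal_edge (V : finType) (G : eograph R V) (e : {set V}) : Prop :=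
  e \in edges G /\ forall f, f \in edges G -> label G e <= label G f.

Definition maximal_edge (V : finType) (G : eograph R V) (e : {set V}) : Prop :=
  e \in edges G /\ forall f, f \in edges G -> label G f <= label G e.

(* [f] embeds [G] as a (not necessarily induced) subgraph of [H], respecting
   the order of the edges. *)
Definition is_copy (V W : finType) (G : eograph R V) (H : eograph R W)
    (f : V -> W) : Prop :=
  [/\ injective f,
      forall d, d \in edges G -> f @: d \in edges H &
      forall d e, d \in edges G -> e \in edges G ->
        (label H (f @: d) < label H (f @: e)) = (label G d < label G e)].

Definition contains (V W : finType) (H : eograph R W) (G : eograph R V) : Prop :=
  exists f, is_copy G H f.

Definition copy_using (V W : finType) (H : eograph R W) (G : eograph R V)
    (e : {set W}) : Prop :=
  exists2 f, is_copy G H f & exists2 d, d \in edges G & f @: d = e.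

Definition missing_edge (W : finType) (H : eograph R W) (e : {set W}) : Prop :=
  #|e| = 2%N /\ e \notin edges H.

(* [H'] is [H] plus the edge [e], inserted somewhere in the linear order: old
   edges keep their relative order, and no other constraint is put on the
   labels of [H'], so [H'] ranges over all positions for [e]. *)
Definition insertion (W : finType) (H : eograph R W) (e : {set W})
    (H' : eograph R W) : Prop :=
  edges H' = e |: edges H /\
  forall d f, d \in edges H -> f \in edges H ->
    (label H' d < label H' f) = (label H d < label H f).

Definition semisaturated (V W : finType) (G : eograph R V) (H : eograph R W) :
    Prop :=
  forall e H', missing_edge H e -> insertion H e H' -> copy_using H' G e.

Definition saturated (V W : finType) (G : eograph R V) (H : eograph R W) :
    Prop :=
  ~ contains H G /\ semisaturated G H.

(* The minimum of [A], and the junk value 0 if [A] is empty. *)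
Definition min_nat (A : set nat) : nat :=
  xget 0%N [set m | A m /\ forall k, A k -> (m <= k)%N].

Definition ssat_e (V : finType) (n : nat) (G : eograph R V) : nat :=
  min_nat [set m | exists H : eograph R 'I_n,
                     semisaturated G H /\ #|edges H| = m].

(* A saturated [H] exists, so that this is a genuine minimum, as soon as [G]
   has an edge: see [sat_e_attained]. *)
Definition sat_e (V : finType) (n : nat) (G : eograph R V) : nat :=
  min_nat [set m | exists H : eograph R 'I_n,
                     saturated G H /\ #|edges H| = m].

Lemma min_natP (A : set nat) : (exists m, A m) ->
  A (min_nat A) /\ forall k, A k -> (min_nat A <= k)%N.
Proof.
move=> [m Am]; rewrite /min_nat.
suff : exists m, [set m | A m /\ forall k, A k -> (m <= k)%N]%classic m.
  by move/(xgetPex 0%N).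
have exA : exists m, `[< A m >] by exists m; apply/asboolP.
case: (ex_minnP exA) => p /asboolP Ap minp; exists p; split=> // k Ak.
by apply: minp; apply/asboolP.
Qed.

Lemma semisaturated_exists (V W : finType) (G : eograph R V) :
  exists H : eograph R W, semisaturated G H.
Proof.
have h2 (e : {set W}) : e \in [set e : {set W} | #|e| == 2%N] -> #|e| = 2%N.
  by rewrite inE => /eqP.
have hl : {in [set e : {set W} | #|e| == 2%N] &,
           injective (fun e : {set W} => (enum_rank e)%:R : R)}.
  move=> d e _ _ /eqP; rewrite eqr_nat => /eqP de.
  by apply: enum_rank_inj; apply: val_inj.
exists (EOGraph h2 hl) => e H' [e2]; by rewrite inE e2.
Qed.

Lemma saturated_exists (V W : finType) (G : eograph R V) :
  (exists e, e \in edges G) -> exists H : eograph R W, saturated G H.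
Proof.
move=> [e0 e0G].
pose P m := `[< exists H : eograph R W, ~ contains H G /\ #|edges H| = m >].
have P0 : exists m, P m.
  have h2 (e : {set W}) : e \in (finset.set0 : {set {set W}}) -> #|e| = 2%N.
    by rewrite inE.
  have hl : {in (finset.set0 : {set {set W}}) &, injective (fun _ => 0 : R)}.
    by move=> d e; rewrite inE.
  exists 0%N; apply/asboolP; exists (EOGraph h2 hl).
  by rewrite /= cards0; split=> // -[f [_ /(_ _ e0G)]]; rewrite inE.
have Pub m : P m -> (m <= #|{set W}|)%N.
  by move=> /asboolP[H [_ <-]]; exact: max_card.
case: (ex_maxnP P0 Pub) => m /asboolP[H [Hfree Hm]] maxm.
exists H; split=> // e H' [_ eH] [eqE ordE].
apply: contrapT => nocopy.
suff /maxm : P m.+1 by rewrite ltnn.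
apply/asboolP; exists H'; split; last by rewrite eqE cardsU1 eH Hm.
move=> [f [finj fE ford]]; have fEH d : d \in edges G -> f @: d \in edges H.
  move=> dG; have := fE d dG; rewrite eqE in_setU1 => /orP[/eqP fde|//].
  by case: nocopy; exists f => //; exists d.
apply: Hfree; exists f; split=> // d d' dG d'G.
by rewrite -ordE ?fEH // ford.
Qed.

Lemma ssat_e_attained (V : finType) (n : nat) (G : eograph R V) :
  (exists H : eograph R 'I_n, semisaturated G H /\ #|edges H| = ssat_e n G) /\
  forall H : eograph R 'I_n, semisaturated G H -> (ssat_e n G <= #|edges H|)%N.
Proof.
have [|exH minH] := @min_natP [set m | exists H : eograph R 'I_n,
                     semisaturated G H /\ #|edges H| = m]%classic.
  by have [H ssH] := semisaturated_exists 'I_n G; exists #|edges H|, H.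
by split=> [//|H ssH]; apply: minH; exists H.
Qed.

Lemma sat_e_attained (V : finType) (n : nat) (G : eograph R V) :
  (exists e, e \in edges G) ->
  (exists H : eograph R 'I_n, saturated G H /\ #|edges H| = sat_e n G) /\
  forall H : eograph R 'I_n, saturated G H -> (sat_e n G <= #|edges H|)%N.
Proof.
move=> G0; have [|exH minH] := @min_natP [set m | exists H : eograph R 'I_n,
                     saturated G H /\ #|edges H| = m]%classic.
  by have [H sH] := saturated_exists 'I_n G0; exists #|edges H|, H.
by split=> [//|H sH]; apply: minH; exists H.
Qed.

End EdgeOrdered.

(* Main.v *)
(** Put a missing edge [xy] at the end of the order where [ab] sits: a new copy
    of [G] must send [ab] to [xy], so the images of [v] and [w] are two common
    neighbours [p], [q] of [x] and [y] such that [x] and [y] order their edges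
    to [p] and [q] in opposite ways.  Toss a fair coin for every ordered pair of
    vertices, and say that [x] survives if the coins of all pairs of
    neighbours of [x] agree with the order of their edges to [x].  Two
    nonadjacent vertices cannot both survive, and a vertex of degree less than
    [k] survives with probability at least [2 ^ - k ^ 2].  So there are at most
    [2 ^ k ^ 2] such vertices, and choosing [k] of order [sqrt (ln n)] leaves
    half of the vertices with degree at least [k]. *)

Require Import Defs.
From mathcomp Require Import all_boot all_order all_algebra.
From mathcomp Require Import all_classical all_reals all_analysis.
From mathcomp Require Import zify.
Import Order.TTheory GRing.Theory Num.Theory.
Import numFieldNormedType.Exports.
Local Open Scope ring_scope.

Set Implicit Arguments.
Unset Strict Implicit.
Unset Printing Implicit Defensive.

(** * Inserting an edge with a chosen label *)

Section Insertion.
Variables (R : realType) (W : finType) (H : eograph R W).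

Lemma edge_neq (x y : W) : [set x; y] \in edges H -> x != y.
Proof. by move=> /card_edge; rewrite cards2; case: (x != y). Qed.

Lemma label_inserted (e : {set W}) (t : R) :
  e \notin edges H -> {in edges H, forall d, label H d != t} ->
  #|e| = 2%N ->
  exists2 H' : eograph R W, insertion H e H' &
    label H' e = t /\ {in edges H, label H' =1 label H}.
Proof.
move=> eH tH e2.
pose l d := if d == e then t else label H d.
have lE : {in edges H, l =1 label H}.
  by move=> d dH; rewrite /l; case: eqP => // de; rewrite -de dH in eH.
have h2 d : d \in e |: edges H -> #|d| = 2%N.
  by rewrite in_setU1 => /orP[/eqP->//|]; exact: card_edge.
have hl : {in e |: edges H &, injective l}.
  move=> d f; rewrite !in_setU1 => /orP[/eqP->|dH] /orP[/eqP->|fH] //.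
  - by rewrite (lE _ fH) /l eqxx => /esym/eqP; rewrite (negPf (tH f fH)).
  - by rewrite (lE _ dH) /l eqxx => /eqP; rewrite (negPf (tH d dH)).
  - by rewrite !lE //; exact: label_inj.
exists (EOGraph h2 hl); last by split=> //=; rewrite /l eqxx.
by split=> // d f dH fH; rewrite /= !lE.
Qed.

Lemma label_bound : exists M : R, {in edges H, forall d, `|label H d| < M}.
Proof.
exists (\sum_(d in edges H) `|label H d| + 1) => d dH.
by rewrite (bigD1 d) //= -addrA ltrDl ltr_wpDl // sumr_ge0.
Qed.

End Insertion.

(** * Oppositely ordered common neighbours of nonadjacent vertices *)

Section Separation.
Variables (R : realType) (V W : finType) (G : eograph R V) (H : eograph R W).
Variables (e0 emax : {set V}) (a b v w : V).
Hypotheses (he0 : minimal_edge G e0) (hemax : maximal_edge G emax).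
Hypothesis hab : [set a; b] \in [set e0; emax].
Hypotheses (hv : v \in nbr G a :&: nbr G b) (hw : w \in nbr G a :&: nbr G b).
Hypothesis hlt : label G [set a; v] < label G [set a; w].
Hypothesis hgt : label G [set b; v] > label G [set b; w].
Hypothesis ssH : semisaturated G H.

(* A new edge put first (last) in the order can only be the image of the
   minimal (maximal) edge. *)
Lemma extremal_copy (e : {set W}) : missing_edge H e ->
  exists2 H' : eograph R W, insertion H e H' &
    {in edges H, label H' =1 label H} /\
    exists2 f, is_copy G H' f & f @: [set a; b] = e.
Proof.
move=> me; have [e2 eH] := me; have [M HM] := label_bound H.
have [abE|abE] : [set a; b] = e0 \/ [set a; b] = emax.
- by move: hab; rewrite in_set2 => /orP[]/eqP; [left|right].
- have [|H' iH' [l'e l'E]] := label_inserted (t := - M) eH _ e2.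
    move=> d dH; apply/eqP => dM; have := HM d dH.
    by rewrite dM normrN ltNge ler_norm.
  exists H' => //; split=> //.
  have [f fc [d dG fde]] := ssH me iH'; exists f => //.
  (* If [d] is not [e0], the image of [e0] comes before [e], so it is an old edge with label below
     [- M], which is impossible. *)
  rewrite abE; have [-> //|ne] := eqVneq e0 d.
  have [e0G e0min] := he0; have [finj fE ford] := fc.
  have lt0 : label G e0 < label G d.
    rewrite lt_neqAle e0min // andbT.
    by apply: contra ne => /eqP/(label_inj e0G dG)->.
  move: lt0 (fE _ e0G); rewrite -ford // fde l'e iH'.1 in_setU1.
  move=> lt0 /orP[/eqP//|fe0]; move: lt0; rewrite l'E //.
  have := HM _ fe0; rewrite ltr_norml => /andP[+ _].
  by move=> /ltW; rewrite leNgt => /negPf->.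
- have [|H' iH' [l'e l'E]] := label_inserted (t := M) eH _ e2.
    move=> d dH; apply/eqP => dM; have := HM d dH.
    by rewrite dM ltNge ler_norm.
  exists H' => //; split=> //.
  have [f fc [d dG fde]] := ssH me iH'; exists f => //.
  rewrite abE; have [-> //|ne] := eqVneq emax d.
  have [e0G e0max] := hemax; have [finj fE ford] := fc.
  have lt0 : label G d < label G emax.
    rewrite lt_neqAle e0max // andbT.
    by apply: contra ne => /eqP/(label_inj dG e0G)->.
  move: lt0 (fE _ e0G); rewrite -ford // fde l'e iH'.1 in_setU1.
  move=> lt0 /orP[/eqP//|fe0]; move: lt0; rewrite l'E //.
  have := HM _ fe0; rewrite ltr_norml => /andP[_].
  by move=> /ltW; rewrite leNgt => /negPf->.
Qed.

Lemma nonadjacent_separated (x y : W) : x != y -> [set x; y] \notin edges H ->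
  exists p q, [/\ p \in nbr H x :&: nbr H y, q \in nbr H x :&: nbr H y,
    label H [set x; p] < label H [set x; q] &
    label H [set y; q] < label H [set y; p]].
Proof.
move=> xy xyH.
have me : missing_edge H [set x; y] by split; rewrite // cards2 xy.
have [H' iH' [l'E [f [finj fE ford] fab]]] := extremal_copy me.
have fset2 (c d : V) : f @: [set c; d] = [set f c; f d].
  by rewrite imsetU1 imset_set1.
move: hv hw; rewrite !inE => /andP[av bv] /andP[aw bw].
(* By injectivity [f u] lies outside [[set x; y]], so the image of such an edge is not the new
   one. *)
have fH c u : c \in [set a; b] -> u \notin [set a; b] ->
    [set c; u] \in edges G -> [set f c; f u] \in edges H.
  move=> cab uab cuG; have := fE _ cuG; rewrite fset2 iH'.1 in_setU1.
  case/orP => // /eqP fcu; have : f u \in f @: [set a; b].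
    by rewrite fab -fcu !inE eqxx orbT.
  by rewrite mem_imset // (negPf uab).
have nab u : [set a; u] \in edges G -> [set b; u] \in edges G ->
    u \notin [set a; b].
  by move=> /edge_neq au /edge_neq bu; rewrite !inE negb_or ![u == _]eq_sym au.
have vab := nab _ av bv; have wab := nab _ aw bw.
have aab : a \in [set a; b] by rewrite !inE eqxx.
have bab : b \in [set a; b] by rewrite !inE eqxx orbT.
have av' := fH _ _ aab vab av; have aw' := fH _ _ aab wab aw.
have bv' := fH _ _ bab vab bv; have bw' := fH _ _ bab wab bw.
move: hlt hgt; rewrite -!ford // !fset2 !l'E // => la lb.
have fxy : [set f a; f b] = [set x; y] by rewrite -fset2.
(* The copy may swap the ends of the edge; then [f v] and [f w] exchange roles. *)
have [[fa fb]|[fa fb]] : (f a = x /\ f b = y) \/ (f a = y /\ f b = x).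
- have: f a \in [set x; y] by rewrite -fxy !inE eqxx.
  have: f b \in [set x; y] by rewrite -fxy !inE eqxx orbT.
  have : x \in [set f a; f b] by rewrite fxy !inE eqxx.
  have : y \in [set f a; f b] by rewrite fxy !inE eqxx orbT.
  rewrite !inE => h1 h2 /orP[]/eqP fb /orP[]/eqP fa;
    rewrite ?fa ?fb in h1 h2 *; auto.
  + by move: h1; rewrite orbb eq_sym (negPf xy).
  + by move: h2; rewrite orbb (negPf xy).
- exists (f v), (f w); rewrite -fa -fb; split=> //; by rewrite !inE ?av' ?aw'.
- exists (f w), (f v); rewrite -fa -fb; split=> //; by rewrite !inE ?bw' ?bv'.
Qed.

End Separation.

(** * Coin tosses and vertices of low degree *)

Section LowDegree.
Variables (R : realType) (W : finType) (H : eograph R W).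

(* The order of the edges at [x], extended to [x] itself as a least element so
   that adjacent vertices are separated too. *)
Definition star_order (x p q : W) : bool :=
  (p == x) || (q != x) && (label H [set x; p] < label H [set x; q]).

Definition closed_nbr (x : W) : {set W} := x |: nbr H x.

Hypothesis sepH : forall x y : W, x != y -> [set x; y] \notin edges H ->
  exists p q, [/\ p \in nbr H x :&: nbr H y, q \in nbr H x :&: nbr H y,
    label H [set x; p] < label H [set x; q] &
    label H [set y; q] < label H [set y; p]].

Lemma star_order_separates (x y : W) : x != y ->
  exists p q, [/\ p \in closed_nbr x :&: closed_nbr y,
    q \in closed_nbr x :&: closed_nbr y &
    star_order x p q != star_order y p q].
Proof.
move=> xy; have [xyH|xyH] := boolP ([set x; y] \in edges H).
  have yxH : [set y; x] \in edges H by rewrite finset.setUC.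
  (* [x] precedes [y] in the order at [x], while nothing but [y] precedes [y] in its own. *)
  exists x, y; rewrite /star_order /closed_nbr !inE !eqxx xyH yxH !orbT.
  by rewrite (negPf xy).
have [p [q []]] := sepH xy xyH.
rewrite !inE => /andP[xp yp] /andP[xq yq] l1 l2; exists p, q.
rewrite /star_order !inE xp xq yp yq !orbT; split=> //.
rewrite l1 ![_ == x]eq_sym ![_ == y]eq_sym.
rewrite (edge_neq xq) (negPf (edge_neq xp)) (edge_neq yq) (negPf (edge_neq yp)).
by rewrite lt_gtF.
Qed.

(** The [family] of these predicates is the set of coin tosses that [x] survives. *)
Definition consistent (x : W) (pq : W * W) : pred bool :=
  [pred c | (pq \in finset.setX (closed_nbr x) (closed_nbr x)) ==>
            (c == star_order x pq.1 pq.2)].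

Lemma consistentE (x : W) (pq : W * W) (c : bool) :
  (c \in consistent x pq) =
  ((pq \in finset.setX (closed_nbr x) (closed_nbr x)) ==>
    (c == star_order x pq.1 pq.2)).
Proof. by []. Qed.

(** The coins of pairs from [closed_nbr x] are forced, all others are free. *)
Lemma card_consistent (x : W) :
  #|family (consistent x)| = (2 ^ (#|{: W * W}| - #|closed_nbr x| ^ 2))%N.
Proof.
rewrite card_family; rewrite foldrE big_map big_enum /=.
rewrite (bigID (mem (finset.setX (closed_nbr x) (closed_nbr x)))) /=.
rewrite big1 ?mul1n => [|i iX]; last first.
  rewrite -(card1 (star_order x i.1 i.2)); apply: eq_card => c.
  by rewrite consistentE iX.
rewrite (eq_bigr (fun=> 2%N)) => [|i iX]; last first.
  rewrite -card_bool; apply: eq_card => c.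
  by rewrite consistentE (negPf iX).
rewrite prod_nat_const; congr (_ ^ _)%N.
rewrite -mulnn -cardsX -[finset.setX _ _ in RHS]finset.setCK -cardsCs.
by apply: eq_card => i; rewrite finset.in_setC.
Qed.

(** Count pairs of a low-degree vertex and a toss it survives: each toss has at most one survivor,
    as two would disagree on the coin of a separating pair. *)
Lemma card_low_degree (k : nat) :
  (#|[set x | (#|nbr H x| < k)%N]| <= 2 ^ k ^ 2)%N.
Proof.
set L := [set x | _]; set N := #|{: W * W}|.
suff le : (#|L| * 2 ^ (N - k ^ 2) <= 2 ^ N)%N.
  rewrite -(leq_pmul2r (expn_gt0 2 (N - k ^ 2))) -expnD.
  by apply: leq_trans le _; rewrite leq_exp2l // -leq_subLR.
have -> : (2 ^ N = #|{ffun W * W -> bool}|)%N by rewrite card_ffun card_bool.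
rewrite -sum_nat_const -sum1_card.
apply: (@leq_trans (\sum_(x in L)
    \sum_(c : {ffun W * W -> bool} | c \in family (consistent x)) 1)).
  apply: leq_sum => x; rewrite inE => xk.
  rewrite sum1_card card_consistent leq_exp2l // leq_sub2l // leq_sqr.
  (* Degree strictly below [k] leaves room for [x] itself in [closed_nbr x]. *)
  by rewrite cardsU1; case: (_ \notin _); rewrite ?add1n // add0n ltnW.
rewrite (exchange_big_dep predT) //=; apply: leq_sum => c _.
rewrite sum1_card; apply/card_le1_eqP => x y /andP[_ cx] /andP[_ cy].
apply/eqP; apply: contraT => yx.
have [p [q [pM qM /eqP[]]]] := star_order_separates yx.
move: pM qM; rewrite !finset.in_setI => /andP[py px] /andP[qy qx].
have := familyP cx (p, q); have := familyP cy (p, q).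
by rewrite !consistentE !finset.in_setX px py qx qy /= => /eqP<- /eqP<-.
Qed.

(** Handshake count: [u] to [[set x; u]] injects [nbr H x] into the edges at [x]. *)
Lemma sum_card_nbr : (\sum_x #|nbr H x| <= 2 * #|edges H|)%N.
Proof.
rewrite mulnC -sum_nat_const.
rewrite [leqRHS](eq_bigr (fun e : {set W} => \sum_(x in e) 1)%N); last first.
  by move=> e /card_edge e2; rewrite sum1_card.
rewrite (exchange_big_dep predT) //=; apply: leq_sum => x _.
rewrite sum1_card -(card_in_imset (f := fun u => [set x; u])).
  apply: subset_leq_card; apply/fintype.subsetP => _ /imsetP[u xu ->].
  by move: xu; rewrite inE => xu; rewrite unfold_in /= xu !inE eqxx.
move=> u u' xu _ /finset.setP/(_ u); rewrite !inE eqxx orbT => /esym.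
move: xu; rewrite inE => /edge_neq; rewrite eq_sym => /negPf-> /=.
by move/eqP.
Qed.

(** The extra 1 in the exponent makes at most half of the vertices low-degree; this half and the
    handshake give the factor 4. *)
Lemma card_edges_lower_bound (k : nat) :
  (2 ^ (k ^ 2).+1 <= #|W|)%N -> (#|W| * k <= 4 * #|edges H|)%N.
Proof.
move=> kW; set L := [set x | (#|nbr H x| < k)%N].
have LW : (2 * #|L| <= #|W|)%N.
  by apply: leq_trans kW; rewrite expnS leq_mul2l card_low_degree.
have LC : (#|~: L| * k <= 2 * #|edges H|)%N.
  apply: leq_trans sum_card_nbr; rewrite -sum_nat_const.
  rewrite [leqRHS](bigID (mem (~: L))) /=; apply: leq_trans (leq_addr _ _).
  by apply: leq_sum => x; rewrite !inE -leqNgt.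
have := cardsC L; nia.
Qed.

End LowDegree.

(** * Choice of [k] and the asymptotic bound *)

(** Take [k] maximal; [4 <= n] gives [1 <= k], so [ln n <= (k + 1) ^ 2 + 1 <= (3 * k) ^ 2]. *)
Lemma sqrt_ln_le (R : realType) (n : nat) : (4 <= n)%N ->
  exists2 k : nat, (2 ^ (k ^ 2).+1 <= n)%N & Num.sqrt (ln n%:R) <= 3 * k%:R :> R.
Proof.
move=> n4; pose P k := (2 ^ (k ^ 2).+1 <= n)%N.
have P1 : P 1%N by [].
have Pn k : P k -> (k <= n)%N.
  move=> Pk; apply: leq_trans (ltnW (ltn_expl k (ltnSn 1))) _; apply: leq_trans Pk.
  by rewrite leq_exp2l //; nia.
have exP : exists k, P k by exists 1%N.
have [k Pk kmax] := ex_maxnP exP Pn; exists k => //.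
have k1 := kmax _ P1.
have nk : (n <= 2 ^ (k.+1 ^ 2).+1)%N.
  by rewrite leqNgt; apply/negP => /ltnW/kmax; rewrite ltnn.
have n0 : 0 < n%:R :> R by rewrite ltr0n; lia.
rewrite -[leRHS]ger0_norm ?mulr_ge0 // -sqrtr_sqr ler_wsqrtr //.
apply: (@le_trans _ _ (ln ((2 : R) ^+ (k.+1 ^ 2).+1))).
  by rewrite ler_ln ?posrE ?exprn_gt0 // -natrX ler_nat.
have ln2 : ln 2 <= 1 :> R.
  by have := @le_ln1Dx R 1; rewrite -[1 + 1]/(2 : R); apply; exact: lt_trans (ltrN10 R) ltr01.
rewrite lnXn //; apply: le_trans (ler_wMn2r (k.+1 ^ 2).+1 ln2) _.
by rewrite -natrM -natrX ler_nat; nia.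
Qed.

Local Open Scope classical_set_scope.
Local Open Scope ring_scope.

Unset Implicit Arguments.

Theorem corollary53 (R : realType) (V : finType) (G : eograph R V)
    (e0 emax : {set V}) (a b v w : V)
    (he0 : minimal_edge G e0) (hemax : maximal_edge G emax)
    (hab : [set a; b]%SET \in [set e0; emax]%SET)
    (hv : v \in nbr G a :&: nbr G b) (hw : w \in nbr G a :&: nbr G b)
    (hlt : label G [set a; v]%SET < label G [set a; w]%SET)
    (hgt : label G [set b; v]%SET > label G [set b; w]%SET) :
  (forall n : nat, (sat_e n G >= ssat_e n G)%N) /\
  ((fun n : nat => (ssat_e n G)%:R : R^o)
     \is 'Omega_\oo (fun n : nat => n%:R * Num.sqrt (ln n%:R) : R^o)).
Proof.
split=> [n|].
  (* The edge [e0] ensures that [sat_e] is a genuine minimum, not the junk value 0. *)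
  have [] := @sat_e_attained R V n G; first by exists e0; case: he0.
  move=> [H [[_ ssH] <-]] _.
  exact: (ssat_e_attained n G).2.
(* 12 is 3 from [sqrt_ln_le] times 4 from [card_edges_lower_bound]. *)
apply/asboolP; exists 12^-1 => //.
exists 4%N => //= n n4.
have [[H [ssH <-]] _] := ssat_e_attained n G.
have [k kn lnk] := sqrt_ln_le R n4.
have sepH := nonadjacent_separated he0 hemax hab hv hw hlt hgt ssH.
have := @card_edges_lower_bound R _ H sepH k; rewrite card_ord => /(_ kn) le4.
rewrite !ger0_norm ?mulr_ge0 ?sqrtr_ge0 // ler_pdivrMl //.
have := ler_wpM2l (ler0n R n) lnk => /le_trans; apply.
by rewrite -!natrM ler_nat; nia.
Qed.
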